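(* Let $r^-\ge0$ be an integer, $l^-=r^-+1$ or $l^-=r^-+2$, set $l^+=r^-$ and $r^+=l^-$, and let $q\ge1$ be an integer. Let $\mathcal{D}_x^-$ and $\mathcal{D}_x^+$ be the (symmetric pair of) optimally accurate first-derivative finite-difference operators with stencils $(l^-,r^-)$ and $(l^+,r^+)$, and let $\mathcal{D}_{xx}$ be the optimally accurate second-derivative operator with centered stencil $q$. Consider the full discretization, by the method of lines, of the partially dissipative wave system $$v_t+p_x-\nu v_{xx}=0,\qquad p_t+v_x=0$$ with periodic boundary conditions on $[0,1]$, combining $\mathcal{D}_x^\pm$ and $\mathcal{D}_{xx}$ with an explicit Runge-Kutta method of order at least $1$. Then there exist positive numbers $\alpha_0,\beta_0,\gamma_0$, determined by $\mathcal{D}_x^\pm$, $\mathcal{D}_{xx}$ and the Runge-Kutta method (in particular independent of $\nu,h,\delta t$), such that for every $\nu>0$, every $h=1/N$ with $N$ a positive integer, and every $\delta t>0$ satisfying $$\delta t<\nu\gamma_0\quad\text{and}\quad\left(\alpha_0+\frac{\nu\beta_0}{h}\right)\frac{\delta t}{h}<1,$$ the fully-discretized method is stable.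
   Context: For a stencil $(l,r)$, the optimally accurate first-derivative operator on the uniform grid with $h=1/N$ is $\mathcal{D}_xw_j=\frac1h\sum_{k=-l}^r a_kw_{j+k}$ (indices modulo $N$) with $$a_k=-\frac{(-1)^k}{k}\frac{l!\,r!}{(l+k)!\,(r-k)!}\ (-l\le k\le r,\ k\neq0),\qquad a_0=-\sum_{-l\le k\le r,\,k\ne0}\frac1k.$$ Denote by $a_k^\mp$ these coefficients for $(l,r)=(l^\mp,r^\mp)$. The pair is called symmetric when $l^-=r^+$ and $r^-=l^+$, so that $a_k^-+a_{-k}^+=0$ for all $k$. The optimally accurate second-derivative operator is $\mathcal{D}_{xx}w_j=\frac1{h^2}\sum_{k=-q}^q b_kw_{j+k}$ with $$b_k=-\frac{2(-1)^k}{k^2}\frac{q!\,q!}{(q+k)!\,(q-k)!}\ (k\ne0),\qquad b_0=-\sum_{k=1}^q\frac{2}{k^2}.$$ The semi-discretization is $$\frac{dv_j}{dt}+\tfrac12\mathcal{D}_x^-(v_j+p_j)-\tfrac12\mathcal{D}_x^+(v_j-p_j)-\nu\mathcal{D}_{xx}v_j=0,\quad \frac{dp_j}{dt}+\tfrac12\mathcal{D}_x^-(v_j+p_j)+\tfrac12\mathcal{D}_x^+(v_j-p_j)=0.$$ With $\boldsymbol{S}$ the $N\times N$ cyclic shift matrix, $(\boldsymbol{S}\boldsymbol{W})_j=w_{j+1}$ (indices modulo $N$), $\boldsymbol{A}^\pm=\sum_k a_k^\pm\boldsymbol{S}^k$, $\boldsymbol{B}=\sum_k b_k\boldsymbol{S}^k$,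 $R=\nu/h$, it reads $\frac{d}{dt}\boldsymbol{U}=\frac1h\boldsymbol{M}\boldsymbol{U}$, where $\boldsymbol{U}$ stacks $(v_j)$ and $(p_j)$ and $$\boldsymbol{M}=-\frac12\begin{bmatrix}\boldsymbol{A}^--\boldsymbol{A}^+&\boldsymbol{A}^-+\boldsymbol{A}^+\\ \boldsymbol{A}^-+\boldsymbol{A}^+&\boldsymbol{A}^--\boldsymbol{A}^+\end{bmatrix}+R\begin{bmatrix}\boldsymbol{B}&\boldsymbol{0}\\ \boldsymbol{0}&\boldsymbol{0}\end{bmatrix}.$$ Time integration: an explicit Runge-Kutta method with $s$ stages has real coefficients $\hat a_{ij}$ ($1\le j<i\le s$) and $\hat b_j$ ($1\le j\le s$) with $\sum_j\hat b_j=1$. Applied with step $\delta t$ and $\mu=\delta t/h$ it yields $\boldsymbol{U}^{n+1}=p_s(\mu\boldsymbol{M})\boldsymbol{U}^n$, where $p_0(z)=1$, $p_{i-1}(z)=1+\sum_{j=1}^{i-1}\hat a_{ij}z\,p_{j-1}(z)$ for $2\le i\le s$, and $p_s(z)=1+\sum_{j=1}^s\hat b_jz\,p_{j-1}(z)$. If the method has order $m$ then $p_s(z)=\sum_{k=0}^m z^k/k!+O(z^{m+1})$ as $z\to0$. The fully-discretized method with given $\nu,h,\delta t$ is stable if the powers $[p_s(\mu\boldsymbol{M})]^n$, $n\ge0$, are bounded, i.e. every numerical solution stays bounded as $n\to\infty$. *)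

(* Defs.v *)
From HB Require Import structures.
From mathcomp Require Import all_boot all_order all_algebra.
From mathcomp Require Import all_classical all_reals all_analysis.

Set Implicit Arguments.
Unset Strict Implicit.
Unset Printing Implicit Defensive.

Import Order.TTheory GRing.Theory Num.Theory.
Import numFieldNormedType.Exports.

Local Open Scope classical_set_scope.
Local Open Scope ring_scope.

Section FiniteDifferences.
Variable R : realType.

(* The offsets [-l <= k <= r] of a stencil are enumerated as [k = i - l] for
   [0 <= i < l + r + 1]; both factorials below have nonnegative arguments on
   this range, so that the absolute values are harmless. *)
Definition fd1_coef (l r : nat) (k : int) : R :=
  if k == 0 then - \sum_(i < (l + r).+1 | i != l :> nat) (i%:Z - l%:Z)%:~R^-1
  else - ((-1) ^ k / k%:~R)
       * ((l`! * r`!)%:R / (`|(l%:Z + k)%R|%N`! * `|(r%:Z - k)%R|%N`!)%:R).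

Definition fd2_coef (q : nat) (k : int) : R :=
  if k == 0 then - \sum_(1 <= j < q.+1) (2 / j%:R ^+ 2)
  else - (2 * (-1) ^ k / k%:~R ^+ 2)
       * ((q`! * q`!)%:R / (`|(q%:Z + k)%R|%N`! * `|(q%:Z - k)%R|%N`!)%:R).

(* [ordS j] is [j + 1] modulo the number of grid points, hence
   [(shift_mx *m W) j = W (j + 1)].  Matrices over the [n.+1] grid points form
   a unit ring, in which [shift_mx ^ k] makes sense for all [k : int] as
   [shift_mx] is invertible. *)
Definition shift_mx (n : nat) : 'M[R]_n.+1 :=
  \matrix_(i, j) (j == ordS i)%:R.

Definition fd1_mx (n l r : nat) : 'M[R]_n.+1 :=
  \sum_(i < (l + r).+1)
    fd1_coef l r (i%:Z - l%:Z) *: shift_mx n ^ (i%:Z - l%:Z).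

Definition fd2_mx (n q : nat) : 'M[R]_n.+1 :=
  \sum_(i < (q + q).+1)
    fd2_coef q (i%:Z - q%:Z) *: shift_mx n ^ (i%:Z - q%:Z).

(* The argument [re] stands for [nu / h]. *)
Definition semidisc_mx (n lm rm lp rp q : nat) (re : R) :
    'M[R]_(n.+1 + n.+1) :=
  let Am := fd1_mx n lm rm in
  let Ap := fd1_mx n lp rp in
  - 2^-1 *: block_mx (Am - Ap) (Am + Ap) (Am + Ap) (Am - Ap)
  + re *: block_mx (fd2_mx n q) 0 0 0.

End FiniteDifferences.

Section RungeKutta.
Variable R : realType.

(* Stages are numbered from 0; only the values [rk_a i j] with [j < i < rk_s]
   and [rk_b j] with [j < rk_s] are used. *)
Record explicit_rk := ExplicitRK {
  rk_s : nat;
  rk_a : nat -> nat -> R;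
  rk_b : nat -> R;
  rk_b_sum : \sum_(j < rk_s) rk_b j = 1 }.

Variable rk : explicit_rk.

(* [rk_stages F y k] lists the first [k] stages
   [Y_i = y + \sum_(j < i) a_ij F (Y_j)], where [F] is the right-hand side
   of the differential equation multiplied by the time step. *)
Fixpoint rk_stages (V : lmodType R) (F : V -> V) (y : V) (k : nat) : seq V :=
  if k is i.+1 then
    let Y := rk_stages F y i in
    rcons Y (y + \sum_(j < i) rk_a rk i j *: F Y`_j)
  else [::].

Definition rk_step (V : lmodType R) (F : V -> V) (y : V) : V :=
  let Y := rk_stages F y (rk_s rk) in
  y + \sum_(j < rk_s rk) rk_b rk j *: F Y`_j.

(* The stability polynomial: the method applied to [u' = z u], [u = 1], with
   [z] replaced by the indeterminate. *)
Definition rk_poly : {poly R} := rk_step (fun u => 'X * u) 1.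

Fixpoint times_diff (V W : normedModType R) (k : nat) (f : V -> W) : Prop :=
  if k is k'.+1 then
    (forall x v, derivable f x v) /\
    (forall v, times_diff k' (fun x => 'D_v f x))
  else continuous f.

(* Order at least [m]: for every smooth autonomous system [y' = f y], the
   error of one step started on the exact solution is [O(tau^(m+1))]. *)
Definition rk_order_ge (m : nat) : Prop :=
  forall (d : nat) (f : 'rV[R]_d.+1 -> 'rV[R]_d.+1) (y : R -> 'rV[R]_d.+1)
         (t0 : R),
    (forall k, times_diff k f) ->
    (\forall t \near t0, is_derive (t : R) (1 : R) y (f (y t))) ->
    (fun tau : R => rk_step (fun u => tau *: f u) (y t0) - y (t0 + tau))
      =O_ (0 : R) (fun tau : R => tau ^+ m.+1).

End RungeKutta.

Definition power_bounded (R : realType) (n : nat) (A : 'M[R]_n.+1) : Prop :=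
  bounded_fun (fun k : nat => A ^+ k).

(* There are [n.+1] grid points, so [h = 1 / n.+1]. *)
Definition stable (R : realType) (lm rm lp rp q : nat) (rk : explicit_rk R)
    (nu : R) (n : nat) (dt : R) : Prop :=
  let h := n.+1%:R^-1 in
  let mu := dt / h in
  power_bounded
    (horner_mx (mu *: semidisc_mx n lm rm lp rp q (nu / h)) (rk_poly rk)).

(* Main.v *)
Require Import Defs.
From mathcomp Require Import all_boot all_order all_algebra.
From mathcomp Require Import all_classical all_reals all_analysis.
From mathcomp Require Import ring lra zify complex separable cyclotomic.
Import Order.TTheory GRing.Theory Num.Theory.
Import numFieldNormedType.Exports.
Local Open Scope ring_scope.

(* Over the eigenvectors of the cyclic shift the matrix [M] splits into 2 x 2
   blocks - [[x + D, i y], [i y, x]], where [x + i y] is the symbol of the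
   backward operator at a root of unity [w] and [D = R g] with [- g] the symbol
   of the second-derivative operator.  Put [s = |1 - w|^2].  Widening a stencil
   by one point changes the first-derivative symbol by a constant times
   [(1 - w)^(l+r+1) / (- w)^(l+1)]; starting from the centered stencil, whose
   symbol is purely imaginary, this gives [x = kappa s^l] with [kappa >= 0].
   Likewise [g] is a polynomial in [s] with nonnegative coefficients and linear
   coefficient 1, hence [g >= s]; moreover [y^2 <= L s].
   The eigenvalues of the block are [-(x + d)] with [d^2 - D d + y^2 = 0].  As
   [p(z) = 1 + z + O(z^2)], one has [|p(z)| < 1] as soon as [K |z|^2 < - Re z]
   and [|z| <= 1].  If [d] is real it lies in [[0, D]], and the second step-size
   condition suffices; otherwise [Re d = D / 2], [|d| = |y|], and the first
   condition makes [mu y^2 <= mu L g] small against [D].  A double eigenvalue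
   is nonzero when [g > 0], so a Jordan block does no harm. *)

Set Implicit Arguments.
Unset Strict Implicit.
Unset Printing Implicit Defensive.

Section Coefficients.
Variable R : realType.

Lemma fd1_coefE (l r i : nat) : (i <= l + r)%N -> i != l ->
  fd1_coef R l r (i%:Z - l%:Z) =
  - ((-1) ^ (i%:Z - l%:Z) / (i%:R - l%:R)) *
    ((l`! * r`!)%:R / (i`! * (l + r - i)`!)%:R).
Proof.
move=> ile neq; rewrite /fd1_coef subr_eq0 eqz_nat (negbTE neq).
rewrite (_ : `|(l%:Z + (i%:Z - l%:Z))%R|%N = i); last by lia.
rewrite (_ : `|(r%:Z - (i%:Z - l%:Z))%R|%N = (l + r - i)%N); last by lia.
by rewrite intrB.
Qed.

Lemma natrB_neq0 (i l : nat) : i != l -> i%:R - l%:R != 0 :> R.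
Proof. by move=> neq; rewrite subr_eq0 eqr_nat. Qed.

Lemma factr_neq0 (m : nat) : m`!%:R != 0 :> R.
Proof. by rewrite pnatr_eq0 -lt0n fact_gt0. Qed.

Lemma natrS_neq0 (m : nat) : 1 + m%:R != 0 :> R.
Proof. by rewrite -mulrS pnatr_eq0. Qed.

Lemma fd1_coefS (l r i : nat) : (i <= l + r)%N ->
  fd1_coef R l.+1 r (i%:Z - l%:Z) = fd1_coef R l r (i%:Z - l%:Z) +
   (-1) ^ (i%:Z - l%:Z) * ((l`! * r`!)%:R / (i.+1`! * (l + r - i)`!)%:R).
Proof.
move=> ile; have [->|neq] := eqVneq i l.
  rewrite subrr expr0z /fd1_coef /= big_mkcond big_ord_recl /= sub0r.
  rewrite [in RHS]big_mkcond opprD addrC; congr (- _ + _).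
    rewrite addSn; apply: eq_bigr => j _; rewrite /bump add1n eqSS.
    by rewrite (_ : j.+1%:Z - l.+1%:Z = j%:Z - l%:Z) //; lia.
  rewrite addKn factS !natrM mulrNz invrN opprK -pmulrn mulrS.
  by field; rewrite ?factr_neq0 ?natrS_neq0.
have -> : i%:Z - l%:Z = i.+1%:Z - l.+1%:Z by lia.
rewrite fd1_coefE ?addSn //.
have -> : i.+1%:Z - l.+1%:Z = i%:Z - l%:Z by lia.
rewrite fd1_coefE // subSS !factS !natrM !mulrS.
by field; rewrite ?factr_neq0 ?natrS_neq0 ?natrB_neq0.
Qed.

Lemma fd1_coefS0 (l r : nat) :
  fd1_coef R l.+1 r (- l.+1%:Z) =
  (-1) ^ (- l.+1%:Z) * ((l`! * r`!)%:R / (l + r).+1`!%:R).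
Proof.
rewrite -[- _]sub0r fd1_coefE // subn0 sub0r addSn fact0 mul1n sub0r.
rewrite factS !natrM mulrS.
by field; rewrite ?factr_neq0 -?natrD ?natrS_neq0.
Qed.

Lemma fd1_coefN (l r : nat) (k : int) : - l%:Z <= k <= r%:Z ->
  fd1_coef R r l (- k) = - fd1_coef R l r k.
Proof.
move=> kb; have [->|neq] := eqVneq k 0.
  rewrite /fd1_coef /= (addnC r l) opprK -sumrN [in RHS]big_mkcond.
  rewrite (reindex_inj rev_ord_inj) [LHS]big_mkcond /=.
  apply: eq_bigr => i _; have := ltn_ord i; rewrite ltnS => ile.
  rewrite subSS.
  have -> : (l + r - i)%N%:Z - r%:Z = - (i%:Z - l%:Z) :> int by lia.
  rewrite (_ : (l + r - i != r)%N = (i != l :> nat)); last by lia.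
  by case: eqVneq => _; rewrite /= ?oppr0 // intrN invrN !opprK.
rewrite /fd1_coef oppr_eq0 (negbTE neq) opprK.
rewrite (_ : (-1) ^ (- k) = (-1) ^ k :> R); last by rewrite -exprz_inv invrN1.
rewrite mulrNz invrN mulrN !mulNr !opprK.
by congr (_ * (_%:R / _%:R)); rewrite mulnC.
Qed.

Lemma fd2_coefE (q i : nat) : (i <= q + q)%N -> i != q ->
  fd2_coef R q (i%:Z - q%:Z) =
  - (2 * (-1) ^ (i%:Z - q%:Z) / (i%:R - q%:R) ^+ 2) *
    ((q`! * q`!)%:R / (i`! * (q + q - i)`!)%:R).
Proof.
move=> ile neq; rewrite /fd2_coef subr_eq0 eqz_nat (negbTE neq).
rewrite (_ : `|(q%:Z + (i%:Z - q%:Z))%R|%N = i); last by lia.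
rewrite (_ : `|(q%:Z - (i%:Z - q%:Z))%R|%N = (q + q - i)%N); last by lia.
by rewrite intrB.
Qed.

Lemma fd2_coefS (q i : nat) : (i <= q + q)%N ->
  fd2_coef R q.+1 (i%:Z - q%:Z) = fd2_coef R q (i%:Z - q%:Z) -
   2 * (-1) ^ (i%:Z - q%:Z) *
     ((q`! * q`!)%:R / (i.+1`! * (q + q - i).+1`!)%:R).
Proof.
move=> ile; have [->|neq] := eqVneq i q.
  rewrite subrr expr0z /fd2_coef /= big_nat_recr //= opprD; congr (_ - _).
  rewrite addnK factS !natrM mulrS.
  by field; rewrite ?factr_neq0 ?natrS_neq0.
have -> : i%:Z - q%:Z = i.+1%:Z - q.+1%:Z by lia.
rewrite fd2_coefE ?addSn ?addnS //; last by rewrite ltnW.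
have -> : i.+1%:Z - q.+1%:Z = i%:Z - q%:Z by lia.
rewrite fd2_coefE // subSS subSn // !factS !natrM !mulrS natrB // natrD.
have key : 1 + (q%:R + q%:R - i%:R) != 0 :> R.
  by rewrite -natrD -natrB // natrS_neq0.
by field; rewrite ?factr_neq0 ?natrS_neq0 ?natrB_neq0 //= ?key.
Qed.

Lemma fd2_coefS_end (q : nat) (k : int) : `|k|%N = q.+1 ->
  fd2_coef R q.+1 k = - 2 * (-1) ^ k * ((q`! * q`!)%:R / (q + q).+2`!%:R).
Proof.
move=> kq; have kn0 : k != 0 by rewrite -absz_gt0 kq.
rewrite /fd2_coef (negbTE kn0).
have -> : (`|(q.+1%:Z + k)%R|%N`! * `|(q.+1%:Z - k)%R|%N`!)%N = (q + q).+2`!.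
  have [kE|kE] : k = q.+1%:Z \/ k = - q.+1%:Z by lia.
    rewrite kE subrr fact0 muln1; congr (_`!); lia.
  rewrite kE subrr fact0 mul1n opprK; congr (_`!); lia.
have -> : k%:~R ^+ 2 = (1 + q%:R) ^+ 2 :> R.
  have [kE|kE] : k = q.+1%:Z \/ k = - q.+1%:Z by lia.
    by rewrite kE -pmulrn mulrS.
  by rewrite kE mulrNz sqrrN -pmulrn mulrS.
have := factr_neq0 (q + q).+2; move: (_.+2`!) => F F0.
by rewrite (factS q) !natrM !mulrS; field; rewrite ?F0 ?natrS_neq0.
Qed.

End Coefficients.

Section Symbols.
Variable R : realType.
Local Notation C := R[i]%C.
Local Notation "x %:C" := (real_complex R x).

Definition fd1_symbol (l r : nat) (w : C) : C :=
  \sum_(i < (l + r).+1) (fd1_coef R l r (i%:Z - l%:Z))%:C * w ^ (i%:Z - l%:Z).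

Definition fd2_symbol (q : nat) (w : C) : C :=
  \sum_(i < (q + q).+1) (fd2_coef R q (i%:Z - q%:Z))%:C * w ^ (i%:Z - q%:Z).

Lemma binomial_symbol (n m : nat) (c : R) (w : C) : w != 0 ->
  \sum_(i < n.+1) ((-1) ^ (i%:Z - m%:Z) * (c / (i`! * (n - i)`!)%:R))%:C
     * w ^ (i%:Z - m%:Z) = (c / n`!%:R)%:C * ((1 - w) ^+ n / (- w) ^+ m).
Proof.
move=> w0; rewrite exprDn mulr_suml mulr_sumr; apply: eq_bigr => i _.
have ile : (i <= n)%N by rewrite -ltnS.
rewrite rmorphM /= fmorphXz rmorphN1 mulrAC -expfzMl mulN1r.
rewrite expfzDr ?oppr_eq0 // -exprnN expr1n mul1r mulrC.
have -> : c / (i`! * (n - i)`!)%:R = c / n`!%:R * 'C(n, i)%:R.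
  rewrite -(bin_fact ile) !natrM.
  have := bin_gt0 n i; rewrite ile -(ltr0n R) => /lt0r_neq0 bn0.
  by field; rewrite ?factr_neq0 ?bn0.
by rewrite rmorphM rmorph_nat -[X in _ = _ * (X / _)]mulr_natl !mulrA.
Qed.

Lemma fd1_symbolS (l r : nat) (w : C) : w != 0 ->
  fd1_symbol l.+1 r w = fd1_symbol l r w +
    ((l`! * r`!)%:R / (l + r).+1`!%:R)%:C * ((1 - w) ^+ (l + r).+1 / (- w) ^+ l.+1).
Proof.
move=> w0; rewrite -binomial_symbol // /fd1_symbol addSn [LHS]big_ord_recl.
rewrite [X in _ = _ + X]big_ord_recl /= addrCA; congr (_ + _).
  by rewrite sub0r fd1_coefS0 fact0 mul1n subn0.
rewrite -big_split; apply: eq_bigr => i _ /=.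
rewrite /bump add1n (_ : i.+1%:Z - l.+1%:Z = i%:Z - l%:Z); last by lia.
have ile : (i <= l + r)%N by rewrite -ltnS.
by rewrite fd1_coefS // subSS rmorphD mulrDl.
Qed.

Lemma fd2_symbolS (q : nat) (w : C) : w != 0 ->
  fd2_symbol q.+1 w = fd2_symbol q w -
    (2 * (q`! * q`!)%:R / (q + q).+2`!%:R)%:C *
      ((1 - w) ^+ (q + q).+2 / (- w) ^+ q.+1).
Proof.
move=> w0; rewrite -binomial_symbol // /fd2_symbol addSn addnS.
rewrite [LHS]big_ord_recl [X in _ = _ - X]big_ord_recl /=.
rewrite [X in _ + X = _]big_ord_recr [X in _ = _ - (_ + X)]big_ord_recr /=.
have aux (a b c a' b' c' f : C) : a = - a' -> c = - c' -> b = f - b' ->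
  a + (b + c) = f - (a' + (b' + c')) by move=> -> -> ->; ring.
apply: aux.
- rewrite sub0r fd2_coefS_end ?abszN // fact0 mul1n subn0.
  rewrite -mulNr -rmorphN /=; congr (_%:C * _).
  by rewrite !mulNr [2 * _ ^ _]mulrC !mulrA.
- rewrite fd2_coefS_end; last by rewrite /bump; lia.
  rewrite subnn fact0 muln1.
  rewrite -mulNr -rmorphN /=; congr (_%:C * _).
  by rewrite !mulNr [2 * _ ^ _]mulrC !mulrA.
rewrite -sumrB; apply: eq_bigr => i _.
rewrite /bump add1n (_ : i.+1%:Z - q.+1%:Z = i%:Z - q%:Z); last by lia.
have ile : (i <= q + q)%N by rewrite -ltnS.
rewrite fd2_coefS // -mulrBl -rmorphB subSS subSn //=.
by congr ((_ - _)%:C * _); rewrite [2 * _ ^ _]mulrC !mulrA.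
Qed.

Lemma fd1_symbolV (l r : nat) (w : C) :
  fd1_symbol r l w^-1 = - fd1_symbol l r w.
Proof.
rewrite /fd1_symbol -sumrN (addnC r l) (reindex_inj rev_ord_inj) /=.
apply: eq_bigr => i _; have := ltn_ord i; rewrite ltnS => ile.
rewrite subSS (_ : (l + r - i)%N%:Z - r%:Z = - (i%:Z - l%:Z)); last by lia.
rewrite exprz_inv opprK fd1_coefN ?rmorphN ?mulNr //; lia.
Qed.

Definition dissipation (w : C) : C := (1 - w) * (1 - w^-1).

Lemma dissipationV (w : C) : dissipation w^-1 = dissipation w.
Proof. by rewrite /dissipation invrK mulrC. Qed.

Lemma dissipationE (w : C) : w != 0 -> dissipation w = 2 - w - w^-1.
Proof. by move=> w0; rewrite /dissipation; field. Qed.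

Lemma dissipationX (m : nat) (w : C) : w != 0 ->
  (1 - w) ^+ (m + m) / (- w) ^+ m = dissipation w ^+ m.
Proof.
move=> w0; rewrite addnn -mul2n exprM -expr_div_n; congr (_ ^+ _).
by rewrite /dissipation; field.
Qed.

Lemma fd2_symbolS_dissipation (q : nat) (w : C) : w != 0 ->
  fd2_symbol q.+1 w = fd2_symbol q w -
    (2 * (q`! * q`!)%:R / (q + q).+2`!%:R)%:C * dissipation w ^+ q.+1.
Proof. by move=> w0; rewrite fd2_symbolS // -dissipationX // addSn addnS. Qed.

Lemma fd1_symbolS_centered (r : nat) (w : C) : w != 0 ->
  fd1_symbol r.+1 r w + fd1_symbol r.+1 r w^-1 =
  ((r`! * r`!)%:R / (r + r).+1`!%:R)%:C * dissipation w ^+ r.+1.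
Proof.
move=> w0; have w0' : w^-1 != 0 by rewrite invr_eq0.
rewrite !fd1_symbolS // addrACA fd1_symbolV subrr add0r -mulrDr.
congr (_ * _).
have term x : x != 0 ->
    (1 - x) ^+ (r + r).+1 / (- x) ^+ r.+1 = (1 - x^-1) * dissipation x ^+ r.
  move=> x0; rewrite -dissipationX // !exprS invfM mulrACA; congr (_ * _).
  by field.
rewrite !term // invrK dissipationV -mulrDl exprS; congr (_ * _).
by rewrite dissipationE //; ring.
Qed.

Lemma fd1_symbolSS_centered (r : nat) (w : C) : w != 0 ->
  fd1_symbol r.+2 r w + fd1_symbol r.+2 r w^-1 =
  ((r`! * r`!)%:R / (r + r).+1`!%:R / 2)%:C * dissipation w ^+ r.+2.
Proof.
move=> w0; have w0' : w^-1 != 0 by rewrite invr_eq0.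
rewrite (fd1_symbolS r.+1 r w0) (fd1_symbolS r.+1 r w0') addrACA.
rewrite fd1_symbolS_centered // -mulrDr.
have -> : ((r.+1`! * r`!)%:R / (r.+1 + r).+1`!%:R : R) =
          (r`! * r`!)%:R / (r + r).+1`!%:R / 2.
  rewrite addSn [(r + r).+2`!]factS [r.+1`!]factS.
  have := factr_neq0 R (r + r).+1; move: ((r + r).+1`!) => F F0.
  rewrite !natrM; have -> : (r + r).+2%:R = 2 * (1 + r%:R) :> R.
    by rewrite !mulrS natrD; ring.
  by rewrite mulrS; field; rewrite ?F0 ?natrS_neq0.
set c : R := _%:R / _ / 2; rewrite (_ : _ / _%:R = 2 * c); last first.
  by rewrite /c mulrCA divff ?mulr1.
rewrite rmorphM /= (rmorph_nat (real_complex R) 2).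
have term x : x != 0 ->
    (1 - x) ^+ (r.+1 + r).+1 / (- x) ^+ r.+2 = - x^-1 * dissipation x ^+ r.+1.
  move=> x0; rewrite -dissipationX // addSn addnS [(- x) ^+ r.+2]exprS.
  by rewrite invfM invrN mulrCA.
rewrite !term // invrK dissipationV -mulrDl [in RHS]exprS.
move: (dissipation w ^+ r.+1) => d.
by rewrite dissipationE //; ring.
Qed.

Lemma fd2_symbolE (q : nat) (w : C) : w != 0 ->
  fd2_symbol q w = - \sum_(j < q)
    (2 * (j`! * j`!)%:R / (j + j).+2`!%:R)%:C * dissipation w ^+ j.+1.
Proof.
move=> w0; elim: q => [|q IHq].
  rewrite /fd2_symbol big_ord1 big_ord0 /fd2_coef /= big_geq //.
  by rewrite oppr0 mul0r oppr0.
by rewrite fd2_symbolS_dissipation // big_ord_recr /= IHq opprD.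
Qed.

End Symbols.

Section UnitCircle.
Variable R : realType.
Local Notation C := R[i]%C.
Local Notation "x %:C" := (real_complex R x).
Local Notation Re := (@complex.Re R).
Local Notation Im := (@complex.Im R).
Local Open Scope complex_scope.
Implicit Types w : C.

Lemma norm_le1_sqr (x y : R) : x ^+ 2 + y ^+ 2 = 1 -> `|x| <= 1.
Proof.
move=> xy; rewrite -(@expr_le1 _ 2) // real_normK ?num_real // -xy.
by rewrite lerDl sqr_ge0.
Qed.

Lemma unit_normE w : `|w| = 1 -> Re w ^+ 2 + Im w ^+ 2 = 1.
Proof.
move=> w1; suff [] : (Re w ^+ 2 + Im w ^+ 2)%:C = 1%:C by [].
by rewrite add_Re2_Im2 w1 expr1n.
Qed.

Lemma unit_norm_neq0 w : `|w| = 1 -> w != 0.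
Proof. by move=> w1; rewrite -normr_eq0 w1 oner_eq0. Qed.

Lemma unit_norm_inv w : `|w| = 1 -> w^-1 = w^*.
Proof.
move=> w1; apply: (mulfI (unit_norm_neq0 w1)); rewrite divff ?unit_norm_neq0 //.
have := unit_normE w1; case: w {w1} => a b /= ab1; simpc.
by rewrite -!expr2 ab1 (mulrC b) addrC subrr.
Qed.

Lemma unit_norm_dissipation w : `|w| = 1 ->
  dissipation w = (2 - 2 * Re w)%:C.
Proof.
move=> w1; rewrite dissipationE ?unit_norm_neq0 // unit_norm_inv // -addrA -opprD.
by rewrite addcJ rmorphB rmorphM /= (rmorph_nat (real_complex R) 2).
Qed.

Lemma fd1_symbol_conj l r w : `|w| = 1 ->
  (fd1_symbol l r w)^* = fd1_symbol l r w^-1.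
Proof.
move=> w1; rewrite unit_norm_inv // [LHS]rmorph_sum; apply: eq_bigr => i _.
by rewrite rmorphM /= fmorphXz oppr0.
Qed.

Lemma Im_sum (I : finType) (F : I -> C) : Im (\sum_i F i) = \sum_i Im (F i).
Proof. by apply: (big_morph Im) => // -[a b] [c d]. Qed.

Lemma Im_exprn w n : `|w| = 1 -> `|Im (w ^+ n)| <= n%:R * `|Im w|.
Proof.
move=> w1; elim: n => [|n IHn]; first by rewrite expr0 /= normr0 mul0r.
rewrite exprS; have := unit_normE w1.
have : Re (w ^+ n) ^+ 2 + Im (w ^+ n) ^+ 2 = 1.
  by apply: unit_normE; rewrite normrX w1 expr1n.
move: IHn; case: (w ^+ n) => c d; case: w {w1} => a b /=.
move=> IHn cd ab.
rewrite mulrS mulrDl mul1r [leRHS]addrC (le_trans (ler_normD _ _)) // !normrM.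
rewrite lerD //; last by rewrite ler_piMr ?(norm_le1_sqr cd).
by rewrite (le_trans _ IHn) // ler_piMl ?(norm_le1_sqr ab).
Qed.

Lemma Im_exprz w (k : int) : `|w| = 1 -> `|Im (w ^ k)| <= `|k|%:~R * `|Im w|.
Proof.
move=> w1; case: k => n; first by rewrite -exprnP Im_exprn.
rewrite NegzE -exprz_inv -exprnP unit_norm_inv // normrN.
have -> : `|Im w| = `|Im (w^*)| by case: (w) => a b /=; rewrite normrN.
by apply: Im_exprn; rewrite -unit_norm_inv // normfV w1 invr1.
Qed.

Lemma Im_fd1_symbol l r : exists2 L : R, 0 <= L &
  forall w, `|w| = 1 -> (Im (fd1_symbol l r w)) ^+ 2 <= L * (2 - 2 * Re w).
Proof.
pose L := \sum_(i < (l + r).+1)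
  `|fd1_coef R l r (i%:Z - l%:Z)| * `|i%:Z - l%:Z|%:~R.
have L0 : 0 <= L by apply: sumr_ge0 => i _; rewrite mulr_ge0 // ler0z.
exists (L ^+ 2); first exact: sqr_ge0.
move=> w w1; have leL : `|Im (fd1_symbol l r w)| <= L * `|Im w|.
  rewrite Im_sum (le_trans (ler_norm_sum _ _ _)) // mulr_suml.
  apply: ler_sum => i _; have := Im_exprz (i%:Z - l%:Z) w1.
  case: (w ^ _) => c d /= dle; rewrite mul0r addr0 normrM -mulrA.
  by rewrite ler_wpM2l.
rewrite -real_normK ?num_real // (le_trans (y := (L * `|Im w|) ^+ 2)) //.
  by rewrite ler_sqr // nnegrE ?mulr_ge0.
rewrite exprMn ler_wpM2l ?sqr_ge0 // real_normK ?num_real //.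
have := unit_normE w1; have := sqr_ge0 (1 - Re w); lra.
Qed.

Lemma symbol_bounds (l r q : nat) : (l = r.+1 \/ l = r.+2) -> (0 < q)%N ->
  exists X G L : R, [/\ 0 <= X, 0 <= G, 0 <= L &
    forall w, `|w| = 1 -> exists x y g : R,
      [/\ fd1_symbol l r w = x +i* y, fd2_symbol q w = (- g)%:C,
          0 <= x <= X, 0 <= g <= G & y ^+ 2 <= L * g] /\
      (g = 0 -> x = 0)].
Proof.
move=> hl; case: q => // q _.
pose c j : R := 2 * (j`! * j`!)%:R / (j + j).+2`!%:R.
have c_ge0 j : 0 <= c j by rewrite divr_ge0 ?mulr_ge0.
pose g s : R := \sum_(j < q.+1) c j * s ^+ j.+1.
have [k k0 kE] : exists2 k : R, 0 <= k & forall w, w != 0 ->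
    fd1_symbol l r w + fd1_symbol l r w^-1 = k%:C * dissipation w ^+ l.
  case: hl => ->.
    by exists ((r`! * r`!)%:R / (r + r).+1`!%:R); rewrite ?divr_ge0 // => w w0;
       rewrite fd1_symbolS_centered.
  by exists ((r`! * r`!)%:R / (r + r).+1`!%:R / 2); rewrite ?divr_ge0 // => w w0;
     rewrite fd1_symbolSS_centered.
have [L L0 LP] := Im_fd1_symbol l r.
exists (k / 2 * 4 ^+ l), (g 4), L; split => //.
- by rewrite mulr_ge0 ?divr_ge0 ?exprn_ge0.
- by apply: sumr_ge0 => j _; rewrite mulr_ge0 ?exprn_ge0.
move=> w w1; have w0 := unit_norm_neq0 w1; have sE := unit_norm_dissipation w1.
have {LP} := LP _ w1; have {kE} := kE _ w0.
rewrite -fd1_symbol_conj // addcJ; move: sE.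
have : 0 <= 2 - 2 * Re w <= 4.
  have := norm_le1_sqr (unit_normE w1); rewrite ler_norml => /andP[? ?].
  by apply/andP; split; lra.
move: (2 - 2 * Re w) => s /andP[s0 s4] sE; rewrite sE => xE yL.
have g_ge : s <= g s.
  rewrite /g big_ord_recl expr1 /c /= !fact0 mulr1 divff ?mul1r ?lerDl //.
  by apply: sumr_ge0 => j _; rewrite mulr_ge0 ?exprn_ge0.
have {}xE : Re (fd1_symbol l r w) = k / 2 * s ^+ l.
  suff [] : (2 * Re (fd1_symbol l r w))%:C = (k * s ^+ l)%:C.
    by move=> h; rewrite mulrAC -h mulrC mulKf.
  rewrite rmorphM /= (rmorph_nat (real_complex R) 2) xE.
  by rewrite rmorphM rmorphXn.
exists (Re (fd1_symbol l r w)), (Im (fd1_symbol l r w)), (g s); split; last first.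
  move=> gs0; have s_eq0 : s = 0 by apply/le_anti; rewrite s0 andbT -gs0.
  by rewrite xE s_eq0 expr0n; case: hl => ->; rewrite mulr0.
split.
- by case: (fd1_symbol l r w).
- rewrite fd2_symbolE // sE rmorphN rmorph_sum; congr (- _).
  by apply: eq_bigr => j _; rewrite -rmorphXn [RHS]rmorphM.
- rewrite xE mulr_ge0 ?divr_ge0 ?exprn_ge0 //= ler_wpM2l ?divr_ge0 //.
  by rewrite lerXn2r // nnegrE.
- rewrite (le_trans s0 g_ge) /=; apply: ler_sum => j _.
  by rewrite ler_wpM2l // lerXn2r // nnegrE.
- by rewrite (le_trans yL) // ler_wpM2l.
Qed.

End UnitCircle.

Section StabilityRegion.
Variable R : realType.
Local Notation C := R[i]%C.
Local Notation "x %:C" := (real_complex R x).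
Local Notation Re := (@complex.Re R).
Local Notation Im := (@complex.Im R).
Local Open Scope complex_scope.

Lemma nth_rk_stages (rk : explicit_rk R) (k j : nat) : (j < k)%N ->
  exists q : {poly R}, (rk_stages rk (fun u => 'X * u) 1 k)`_j = 1 + 'X * q.
Proof.
elim: k j => // k IHk j; rewrite ltnS leq_eqVlt => jk /=.
have sz m : size (rk_stages rk (fun u : {poly R} => 'X * u) 1 m) = m.
  by elim: m => //= m IHm; rewrite size_rcons IHm.
rewrite nth_rcons sz; case/orP: jk => [/eqP ->|jk]; last by rewrite jk; exact: IHk.
rewrite ltnn eqxx; exists (\sum_(i < k)
  rk_a rk k i *: (rk_stages rk (fun u => 'X * u) 1 k)`_i).
rewrite mulr_sumr; congr (_ + _).
by apply: eq_bigr => i _; rewrite -scalerAr.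
Qed.

Lemma rk_polyE (rk : explicit_rk R) :
  exists r : {poly R}, rk_poly rk = 1 + 'X + 'X^2 * r.
Proof.
have /choice [q qE] : forall j, exists q : {poly R}, (j < rk_s rk)%N ->
    (rk_stages rk (fun u => 'X * u) 1 (rk_s rk))`_j = 1 + 'X * q.
  move=> j; case: (ltnP j (rk_s rk)) => [jlt|_]; last by exists 0.
  by have [q qE] := nth_rk_stages rk jlt; exists q.
exists (\sum_(j < rk_s rk) rk_b rk j *: q j).
rewrite /rk_poly /rk_step -addrA; congr (_ + _).
rewrite mulr_sumr -[X in _ = X + _]scale1r -(rk_b_sum rk) scaler_suml -big_split.
apply: eq_bigr => j _ /=; rewrite qE; last exact: ltn_ord.
rewrite -scalerAr -scalerDr; congr (_ *: _).
by ring.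
Qed.

Lemma horner_norm_bound (r : {poly C}) : exists2 K : R, 0 <= K &
  forall z, `|z| <= 1 -> `|r.[z]| <= K%:C.
Proof.
have normE (x : C) : (Re `|x|)%:C = `|x| by rewrite normc_def.
exists (\sum_(i < size r) Re `|r`_i|).
  by apply: sumr_ge0 => i _; rewrite -ler0c normE.
move=> z z1; rewrite horner_coef (le_trans (ler_norm_sum _ _ _)) // rmorph_sum.
apply: ler_sum => i _; rewrite normrM normrX /= normE.
by rewrite -[leRHS]mulr1 ler_wpM2l // exprn_ile1.
Qed.

Lemma stability_region (r : {poly C}) : exists2 K : R, 1 <= K &
  forall z : C, K * (Re z ^+ 2 + Im z ^+ 2) < - Re z ->
    Re z ^+ 2 + Im z ^+ 2 <= 1 -> `|(1 + 'X + 'X^2 * r).[z]| < 1.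
Proof.
have [K K0 KP] := horner_norm_bound r; exists (1 + K); first by rewrite lerDl.
move=> z zK z1; have n2 := add_Re2_Im2 z.
have nz1 : `|z| <= 1.
  by rewrite -(@expr_le1 _ 2) // -n2 -[1]/(1%:C) lecR.
rewrite !hornerE.
have le1 : `|1 + z| <= (1 + Re z + (Re z ^+ 2 + Im z ^+ 2) / 2)%:C.
  rewrite normc_def lecR; case: (z) => a b /=.
  have h : 0 <= 1 + a + (a ^+ 2 + b ^+ 2) / 2.
    by have := sqr_ge0 (1 + a); have := sqr_ge0 b; nra.
  rewrite -ler_sqr ?nnegrE ?sqrtr_ge0 // sqr_sqrtr ?addr_ge0 ?sqr_ge0 //.
  by rewrite add0r; have := sqr_ge0 (a + (a ^+ 2 + b ^+ 2) / 2); nra.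
have m0 : 0 <= Re z ^+ 2 + Im z ^+ 2 by rewrite addr_ge0 ?sqr_ge0.
move: (_ + Im z ^+ 2) m0 zK z1 n2 le1 => m m0 zK z1 n2 le1.
rewrite (le_lt_trans (ler_normD _ _)) //.
rewrite (@le_lt_trans _ _ ((1 + Re z + m / 2)%:C + (m * K)%:C)) //.
  apply: lerD => //; rewrite normrM rmorphM /= n2 normrX.
  by rewrite ler_pM ?normr_ge0 ?exprn_ge0 // KP.
rewrite -rmorphD -[ltRHS]/(1%:C) ltcR; nra.
Qed.

(* [re] stands for [nu / h], and [z] is an eigenvalue of a 2 x 2 block of
   [mu M]. *)
Lemma mode_eigenvalue (X G L K x y g mu re : R) (d : C) :
  1 <= K -> 0 <= L -> 0 < mu -> 0 < re ->
  0 <= x <= X -> 0 < g <= G -> y ^+ 2 <= L * g ->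
  K * mu * (X + re * G) < 1 -> 2 * K * mu * L < re ->
  d ^+ 2 - (re * g)%:C * d + (y ^+ 2)%:C = 0 ->
  let z := - mu%:C * (x%:C + d) in
  z = 0 \/ (K * (Re z ^+ 2 + Im z ^+ 2) < - Re z /\ Re z ^+ 2 + Im z ^+ 2 <= 1).
Proof.
move=> K1 L0 mu0 re0 /andP[x0 xX] /andP[g0 gG] yL small1 small2.
case: d => u v eqd.
have D0 : 0 < re * g by rewrite mulr_gt0.
have xyE : - mu%:C * (x%:C + (u +i* v)) = (- (mu * (x + u))) +i* (- (mu * v)).
  by simpc; congr (_ +i* _); ring.
rewrite xyE /=.
have [eqRe eqIm] : u ^+ 2 - v ^+ 2 - re * g * u + y ^+ 2 = 0 /\
    2 * u * v - re * g * v = 0.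
  have -> : u ^+ 2 - v ^+ 2 - re * g * u + y ^+ 2 =
    Re ((u +i* v) ^+ 2 - (re * g)%:C * (u +i* v) + (y ^+ 2)%:C).
    by rewrite [(_ +i* _) ^+ 2]expr2; simpc => /=; ring.
  have -> : 2 * u * v - re * g * v =
    Im ((u +i* v) ^+ 2 - (re * g)%:C * (u +i* v) + (y ^+ 2)%:C).
    by rewrite [(_ +i* _) ^+ 2]expr2; simpc => /=; ring.
  by rewrite eqd.
have xD : K * (mu * (x + re * g)) < 1.
  rewrite mulrA (le_lt_trans _ small1) // ler_wpM2l ?mulr_ge0 ?(ltW mu0) //.
    by rewrite (le_trans _ K1).
  by rewrite lerD // ler_wpM2l // ltW.
have K0 : 0 < K by rewrite (lt_le_trans _ K1).
have [v0|v0] := eqVneq v 0.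
  have u0 : 0 <= u.
    by rewrite leNgt; apply/negP => u0; have := sqr_ge0 y; move: eqRe; rewrite v0; nra.
  have uD : u <= re * g.
    by rewrite leNgt; apply/negP => u1; have := sqr_ge0 y; move: eqRe; rewrite v0; nra.
  have : 0 <= mu * (x + u) by rewrite mulr_ge0 ?addr_ge0 ?(ltW mu0).
  have : K * (mu * (x + u)) < 1.
    rewrite (le_lt_trans _ xD) // ler_wpM2l ?(ltW K0) //.
    by rewrite ler_wpM2l ?(ltW mu0) // lerD2l.
  rewrite v0 mulr0 oppr0 expr0n addr0 sqrrN opprK; move: (mu * (x + u)) => t Kt t0.
  have [->|tn0] := eqVneq t 0; first by left; rewrite oppr0.
  have {t0 tn0} : 0 < t by rewrite lt_def tn0.
  by right; split; nra.
have uE : u = re * g / 2.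
  apply: (mulfI (_ : 2 != 0)) => //; apply: (mulIf v0).
  by rewrite mulrCA divff // mulr1; apply/eqP; rewrite -subr_eq0 eqIm.
right; rewrite opprK !sqrrN.
have vE : v ^+ 2 = y ^+ 2 - (re * g / 2) ^+ 2 by rewrite -uE; move: eqRe uE; nra.
have nE : (mu * (x + u)) ^+ 2 + (mu * v) ^+ 2 =
    mu * (mu * (x * (x + re * g)) + mu * y ^+ 2).
  by rewrite !exprMn vE uE; field.
have lt : K * (mu * (mu * (x * (x + re * g)) + mu * y ^+ 2)) < mu * (x + u).
  rewrite mulrCA ltr_pM2l // mulrDr ler_ltD //.
    by rewrite (mulrCA mu) mulrCA ler_piMr // ltW.
  rewrite (@le_lt_trans _ _ (K * (mu * (L * g)))) //.
    by rewrite ler_wpM2l ?(ltW K0) // ler_wpM2l ?(ltW mu0).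
  by rewrite uE ltr_pdivlMr //; nra.
rewrite nE; split=> //.
have t1 : K * (mu * (x + u)) < 1.
  rewrite (le_lt_trans _ xD) // ler_wpM2l ?(ltW K0) // ler_wpM2l ?(ltW mu0) //.
  by rewrite lerD2l uE; lra.
move: lt t1; move: (mu * (x + u)) (mu * (_ + _)) => t m; nra.
Qed.

End StabilityRegion.

Section OrbitBounded.
Variables (C : numFieldType) (m : nat).
Implicit Types (A Z : 'M[C]_m.+1) (v w : 'rV[C]_m.+1) (p : {poly C}).

Definition orbit_bounded A v :=
  exists B : C, forall k j, `|(v *m A ^+ k) 0 j| <= B.

Lemma orbit_bounded0 A : orbit_bounded A 0.
Proof. by exists 0 => k j; rewrite mul0mx mxE normr0. Qed.

Lemma orbit_boundedD A v w :
  orbit_bounded A v -> orbit_bounded A w -> orbit_bounded A (v + w).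
Proof.
move=> [B vB] [B' wB]; exists (B + B') => k j.
by rewrite mulmxDl mxE (le_trans (ler_normD _ _)) ?lerD.
Qed.

Lemma orbit_boundedZ A (a : C) v : orbit_bounded A v -> orbit_bounded A (a *: v).
Proof.
move=> [B vB]; exists (`|a| * B) => k j.
by rewrite -scalemxAl mxE normrM ler_wpM2l.
Qed.

Lemma orbit_bounded_sum A (I : finType) (f : I -> 'rV[C]_m.+1) :
  (forall i, orbit_bounded A (f i)) -> orbit_bounded A (\sum_i f i).
Proof.
move=> fB; apply: big_ind => [|v w|i _] //; first exact: orbit_bounded0.
exact: orbit_boundedD.
Qed.

Lemma orbit_bounded_eigen A v (g : C) :
  v *m A = g *: v -> `|g| <= 1 -> orbit_bounded A v.
Proof.
move=> vA g1; exists (\sum_j `|v 0 j|) => k j.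
have -> : v *m A ^+ k = g ^+ k *: v.
  elim: k => [|k IHk]; first by rewrite !expr0 mulmx1 scale1r.
  by rewrite exprSr -mulmxE mulmxA IHk -scalemxAl vA scalerA exprSr.
rewrite mxE normrM normrX (le_trans (y := `|v 0 j|)) //.
  by rewrite ler_piMl // exprn_ile1.
by rewrite (bigD1 j) //= lerDl sumr_ge0.
Qed.

Lemma orbit_bounded_jordan A v w (g : C) :
  v *m A = g *: v + w -> w *m A = g *: w -> `|g| < 1 -> orbit_bounded A v.
Proof.
move=> vA wA g1; have g1' : 0 < 1 - `|g| by rewrite subr_gt0.
pose B j := `|v 0 j| + `|w 0 j| / (1 - `|g|).
have B0 j : 0 <= B j by rewrite addr_ge0 ?divr_ge0 ?(ltW g1').
exists (\sum_j B j) => k j; rewrite (@le_trans _ _ (B j)) //; last first.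
  by rewrite (bigD1 j) //= lerDl sumr_ge0.
elim: k => [|k IHk].
  by rewrite expr0 mulmx1 lerDl divr_ge0 // ltW.
have wAk : w *m A ^+ k = g ^+ k *: w.
  elim: (k) => [|i IHi]; first by rewrite !expr0 mulmx1 scale1r.
  by rewrite exprSr -mulmxE mulmxA IHi -scalemxAl wA scalerA exprSr.
rewrite exprS -mulmxE mulmxA vA mulmxDl -scalemxAl wAk.
rewrite mxE [X in X + _]mxE [X in _ + X]mxE.
rewrite (le_trans (ler_normD _ _)) // !normrM normrX.
apply: (@le_trans _ _ (`|g| * B j + `|w 0 j|)).
  by rewrite lerD ?ler_wpM2l // ler_piMl // exprn_ile1 // ltW.
have wE : `|w 0 j| = (1 - `|g|) * (`|w 0 j| / (1 - `|g|)).
  by rewrite mulrCA divff ?mulr1 // gt_eqF.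
rewrite [X in _ + X]wE /B mulrDr -addrA -mulrDl subrKC mul1r lerD2r.
by rewrite ler_piMl // ltW.
Qed.

Lemma mulmx_horner_jordan Z v w (z : C) p :
  v *m Z = z *: v + w -> w *m Z = z *: w ->
  v *m horner_mx Z p = p.[z] *: v + p^`().[z] *: w.
Proof.
move=> vZ wZ; elim/poly_ind: p => [|p c IHp].
  by rewrite rmorph0 mulmx0 deriv0 !horner0 !scale0r addr0.
rewrite derivD derivM derivX derivC !hornerE.
rewrite rmorphD rmorphM /= horner_mx_X horner_mx_C mulmxDr mul_mx_scalar.
rewrite -mulmxE mulmxA IHp mulmxDl -!scalemxAl vZ wZ.
by apply/rowP => j; rewrite !mxE; ring.
Qed.

Lemma mulmx_horner_eigen Z v (z : C) p :
  v *m Z = z *: v -> v *m horner_mx Z p = p.[z] *: v.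
Proof.
move=> vZ; rewrite (@mulmx_horner_jordan Z v 0 z) ?addr0 ?mul0mx ?scaler0 //.
by rewrite addr0.
Qed.

Lemma orbit_bounded_quadratic Z v (z1 z2 : C) p :
  v *m Z *m Z = (z1 + z2) *: (v *m Z) - (z1 * z2) *: v ->
  `|p.[z1]| <= 1 -> `|p.[z2]| <= 1 -> (z1 = z2 -> `|p.[z1]| < 1) ->
  orbit_bounded (horner_mx Z p) v.
Proof.
move=> vZZ p1 p2 p12.
have eig z z' : v *m Z *m Z = (z + z') *: (v *m Z) - (z * z') *: v ->
    (v *m Z - z *: v) *m Z = z' *: (v *m Z - z *: v).
  move=> h; rewrite mulmxBl h -scalemxAl; move: (v *m Z) => u.
  by apply/rowP => j; rewrite !mxE; ring.
have [eqz|neqz] := eqVneq z1 z2.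
  apply: (@orbit_bounded_jordan _ _ (p^`().[z1] *: (v *m Z - z1 *: v)) p.[z1]).
  - apply: mulmx_horner_jordan; first by rewrite addrC subrK.
    by rewrite (eig z1 z2) // eqz.
  - rewrite -scalemxAl (@mulmx_horner_eigen _ _ z1) ?scalerA 1?mulrC //.
    by rewrite (eig z1 z2) // eqz.
  - exact: p12.
have -> : v = (z2 - z1)^-1 *: ((v *m Z - z1 *: v) - (v *m Z - z2 *: v)).
  rewrite (_ : _ - _ = (z2 - z1) *: v).
    rewrite scalerA mulVf ?scale1r // subr_eq0 eq_sym //.
  by move: (v *m Z) => u; apply/rowP => j; rewrite !mxE; ring.
rewrite scalerBr -scaleNr; apply: orbit_boundedD; apply: orbit_boundedZ.
  apply: orbit_bounded_eigen p2; apply: mulmx_horner_eigen.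
  exact: eig.
apply: orbit_bounded_eigen p1; apply: mulmx_horner_eigen; apply: eig.
by rewrite [z2 + z1]addrC [z2 * z1]mulrC.
Qed.

End OrbitBounded.

Section Complexification.
Variable R : realType.
Local Notation C := R[i]%C.
Local Notation "x %:C" := (real_complex R x).
Local Notation toC := (map_mx (real_complex R)).
Local Notation Re := (@complex.Re R).
Local Notation Im := (@complex.Im R).
Local Open Scope complex_scope.

Lemma power_bounded_complex (m : nat) (A : 'M[R]_m.+1) (Q : 'M[C]_m.+1) :
  Q \in unitmx -> (forall i, orbit_bounded (toC A) (row i Q)) -> power_bounded A.
Proof.
move=> Qu QB.
have /choice [B BP] : forall i : 'I_m.+1, exists B : C,
    forall k j, `|(delta_mx 0 i *m (toC A) ^+ k : 'rV_m.+1) 0 j| <= B.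
  move=> i; suff : orbit_bounded (toC A) (delta_mx 0 i) by [].
  have -> : delta_mx 0 i = \sum_j (invmx Q i j *: row j Q) :> 'rV[C]_m.+1.
    by rewrite -[LHS]mulmx1 -(mulVmx Qu) mulmxA -rowE mulmx_sum_row;
      apply: eq_bigr => j _; rewrite mxE.
  by apply: orbit_bounded_sum => j; exact: orbit_boundedZ.
have B0 i : 0 <= B i by apply: le_trans (BP i 0 i); exact: normr_ge0.
exists (Re (\sum_i B i)); split; first exact: num_real.
move=> M ltM k _ /=; apply: le_trans (ltW ltM).
have Re0 : 0 <= Re (\sum_i B i).
  by have : 0 <= \sum_i B i; [exact: sumr_ge0 | rewrite lecE => /andP[_ ->]].
rewrite -[leLHS]/(mx_norm (A ^+ k)) mx_normrE; apply/bigmax_leP; split=> // -[i j] _ /=.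
have : `|((A ^+ k) i j)%:C| <= \sum_i B i.
  apply: (@le_trans _ _ (B i)); last by rewrite (bigD1 i) //= lerDl sumr_ge0.
  have := BP i k j; rewrite -rowE mxE.
  by rewrite -(rmorphXn toC k A) mxE.
by rewrite normc_def /= expr0n addr0 sqrtr_sqr lecE => /andP[_].
Qed.

Lemma shift_mxX (n k : nat) (i j : 'I_n.+1) :
  (shift_mx R n ^+ k) i j = (j == iter k (@ordS n.+1) i)%:R.
Proof.
elim: k i => [|k IHk] i; first by rewrite expr0 mxE eq_sym.
rewrite exprS -mulmxE mxE (bigD1 (ordS i)) //= big1 ?addr0 => [|l /negbTE li].
  by rewrite mxE eqxx mul1r IHk -iterSr.
by rewrite mxE li mul0r.
Qed.

Lemma shift_mx_order (n : nat) : shift_mx R n ^+ n.+1 = 1.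
Proof.
apply/matrixP => i j; rewrite shift_mxX mxE eq_sym; congr (_ == _)%:R.
apply: val_inj; have iterE k : iter k (@ordS n.+1) i = ((i + k) %% n.+1)%N :> nat.
  elim: k => [|k IHk]; first by rewrite addn0 modn_small.
  by rewrite iterS /= IHk addnS -addn1 modnDml addn1.
by rewrite -[LHS]/(nat_of_ord _) iterE modnDr modn_small.
Qed.

Lemma shift_mx_diagonalizable (n : nat) :
  exists2 P : 'M[C]_n.+1, P \in unitmx & forall i, exists w : C,
    `|w| = 1 /\ row i P *m (toC (shift_mx R n)) = w *: row i P.
Proof.
have SX : (toC (shift_mx R n)) ^+ n.+1 = 1.
  by rewrite -(rmorphXn toC) /= shift_mx_order map_mx1.
have : diagonalizable (toC (shift_mx R n)).
  apply/diagonalizableP.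
  have [rs Ers] := closed_field_poly_normal ('X^(n.+1) - 1 : {poly C}).
  rewrite lead_coefXnsubC // scale1r in Ers.
  exists rs.
    rewrite -separable_prod_XsubC -Ers; apply: separable_Xn_sub_1.
    by rewrite pnatr_eq0.
  rewrite -Ers; apply: mxminpoly_min.
  by rewrite rmorphB rmorphXn rmorph1 /= horner_mx_X SX subrr.
move=> [P Pu /diagonalizable_forPex [d /(simmxP Pu) Pd]]; exists P => // i.
have rowi : row i P *m (toC (shift_mx R n)) = d 0 i *: row i P.
  by rewrite -row_mul Pd row_mul row_diag_mx -scalemxAl -rowE.
exists (d 0 i); split=> //.
have rowX k : row i P *m (toC (shift_mx R n)) ^+ k = d 0 i ^+ k *: row i P.
  elim: k => [|k IHk]; first by rewrite !expr0 mulmx1 scale1r.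
  by rewrite exprSr -mulmxE mulmxA IHk -scalemxAl rowi scalerA exprSr.
have rowi0 : row i P != 0.
  apply: contraTneq isT => rowi0; suff : (1 : C) == 0 by rewrite oner_eq0.
  have : row i P *m invmx P = 0 by rewrite rowi0 mul0mx.
  by rewrite rowE mulmxK // => /matrixP /(_ 0 i); rewrite !mxE !eqxx /= => /eqP.
have := rowX n.+1; rewrite SX mulmx1 -[LHS]scale1r => /eqP.
rewrite -subr_eq0 -scalerBl scaler_eq0 (negbTE rowi0) orbF subr_eq0 eq_sym.
by move=> /eqP wn1; apply/eqP; rewrite -(@pexpr_eq1 _ _ n.+1) // -normrX wn1 normr1.
Qed.

Section EigenRows.
Variables (n : nat) (u : 'rV[C]_n.+1) (w : C).
Hypotheses (w0 : w != 0) (uS : u *m toC (shift_mx R n) = w *: u).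

Lemma mulmx_shift_mxXz (k : int) : u *m toC (shift_mx R n ^ k) = w ^ k *: u.
Proof.
have uX m : u *m toC (shift_mx R n ^+ m) = w ^+ m *: u.
  elim: m => [|m IHm]; first by rewrite !expr0 map_mx1 mulmx1 scale1r.
  by rewrite exprSr -mulmxE map_mxM mulmxA IHm -scalemxAl uS scalerA exprSr.
case: k => m; first exact: uX.
have Sunit : shift_mx R n ^+ m.+1 \is a GRing.unit.
  by rewrite unitrX // -(unitrX_pos _ (ltn0Sn n)) shift_mx_order unitr1.
rewrite NegzE -!exprnN; apply: (canRL (scalerK (expf_neq0 m.+1 w0))).
by rewrite scalemxAl -uX -mulmxA -map_mxM mulmxE divrr // map_mx1 mulmx1.
Qed.

Lemma mulmx_fd1_mx (l r : nat) :
  u *m toC (fd1_mx R n l r) = fd1_symbol l r w *: u.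
Proof.
rewrite /fd1_mx map_mx_sum mulmx_sumr scaler_suml; apply: eq_bigr => i _.
by rewrite map_mxZ -scalemxAr mulmx_shift_mxXz scalerA.
Qed.

Lemma mulmx_fd2_mx (q : nat) :
  u *m toC (fd2_mx R n q) = fd2_symbol q w *: u.
Proof.
rewrite /fd2_mx map_mx_sum mulmx_sumr scaler_suml; apply: eq_bigr => i _.
by rewrite map_mxZ -scalemxAr mulmx_shift_mxXz scalerA.
Qed.

Lemma mulmx_semidisc_mx (lm rm lp rp q : nat) (re : R) (a b : C) :
  let Am := fd1_symbol lm rm w in
  let Ap := fd1_symbol lp rp w in
  row_mx (a *: u) (b *: u) *m toC (semidisc_mx n lm rm lp rp q re) =
  row_mx ((- 2^-1 * (a * (Am - Ap) + b * (Am + Ap)) +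
            re%:C * a * fd2_symbol q w) *: u)
         ((- 2^-1 * (a * (Am + Ap) + b * (Am - Ap))) *: u).
Proof.
move=> Am Ap.
rewrite /semidisc_mx map_mxD !map_mxZ !map_block_mx !map_mxD !map_mxN map_mx0.
rewrite mulmxDr -!scalemxAr !mul_row_block -!scalemxAl !mulmxDr !mulmxN.
rewrite !mulmx_fd1_mx mulmx_fd2_mx !mulmx0 rmorphN fmorphV rmorph_nat.
rewrite !scale_row_mx add_row_mx; congr row_mx.
  by apply/rowP => j; rewrite !mxE -/Am -/Ap /=; ring.
by apply/rowP => j; rewrite !mxE -/Am -/Ap; ring.
Qed.

End EigenRows.

End Complexification.

Section Modes.
Variable R : realType.
Local Notation C := R[i]%C.
Local Notation "x %:C" := (real_complex R x).
Local Notation toC := (map_mx (real_complex R)).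
Local Notation Re := (@complex.Re R).
Local Notation Im := (@complex.Im R).
Local Open Scope complex_scope.

Lemma orbit_bounded_mode (n l r q : nat) (u : 'rV[C]_n.+1) (w : C) (p : {poly C})
    (X G L K x y g mu re : R) (a b : C) :
  `|w| = 1 -> u *m toC (shift_mx R n) = w *: u ->
  p.[0] = 1 ->
  (forall z : C, K * (Re z ^+ 2 + Im z ^+ 2) < - Re z ->
     Re z ^+ 2 + Im z ^+ 2 <= 1 -> `|p.[z]| < 1) ->
  1 <= K -> 0 <= L -> 0 < mu -> 0 < re ->
  fd1_symbol l r w = x +i* y -> fd2_symbol q w = (- g)%:C ->
  0 <= x <= X -> 0 <= g <= G -> y ^+ 2 <= L * g -> (g = 0 -> x = 0) ->
  K * mu * (X + re * G) < 1 -> 2 * K * mu * L < re ->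
  orbit_bounded (horner_mx (toC (mu *: semidisc_mx n l r r l q re)) p)
    (row_mx (a *: u) (b *: u)).
Proof.
move=> w1 uS p0 pK K1 L0 mu0 re0 F1 F2 xX gG yL gx small1 small2.
have w0 := unit_norm_neq0 w1.
set Z := toC _; pose J : C := 0 +i* y; pose D := re * g.
have vZ c d : row_mx (c *: u) (d *: u) *m Z =
    row_mx ((- mu%:C * ((x%:C + D%:C) * c + J * d)) *: u)
           ((- mu%:C * (J * c + x%:C * d)) *: u).
  rewrite /Z map_mxZ -scalemxAr (mulmx_semidisc_mx w0 uS) scale_row_mx !scalerA.
  have -> : fd1_symbol r l w = - x%:C + J.
    rewrite -[w in LHS]invrK fd1_symbolV -fd1_symbol_conj // F1 /J.
    by simpc.
  have -> : fd1_symbol l r w = x%:C + J by rewrite F1 /J; simpc.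
  rewrite F2 rmorphN /D rmorphM /=.
  by congr (row_mx (_ *: u) (_ *: u)); field.
have [g_eq0|g_neq0] := eqVneq g 0.
  have y0 : y = 0.
    by apply/eqP; move: yL; rewrite g_eq0 mulr0 -sqrf_eq0 eq_le sqr_ge0 andbT.
  apply: (@orbit_bounded_eigen _ _ _ _ 1); last by rewrite normr1.
  rewrite -p0; apply: mulmx_horner_eigen.
  have [J0 D0 x0] : [/\ J = 0, D%:C = 0 & x%:C = 0].
    by rewrite /J y0 /D g_eq0 mulr0 gx.
  by rewrite vZ J0 D0 x0 addr0 !mul0r addr0 mulr0 !scale0r row_mx0.
have g0 : 0 < g by rewrite lt_def g_neq0; case/andP: gG.
have gG' : 0 < g <= G by rewrite g0; case/andP: gG.
pose d : C := (D%:C + sqrtC (D%:C ^+ 2 - 4 * (y ^+ 2)%:C)) / 2.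
have dE : d ^+ 2 - D%:C * d + (y ^+ 2)%:C = 0.
  have := sqrtCK (D%:C ^+ 2 - 4 * (y ^+ 2)%:C); rewrite /d.
  move: (sqrtC _) => s sE; have -> : (y ^+ 2)%:C = (D%:C ^+ 2 - s ^+ 2) / 4.
    by rewrite sE; field.
  by field.
have dE' : (D%:C - d) ^+ 2 - D%:C * (D%:C - d) + (y ^+ 2)%:C = 0.
  by rewrite -dE; ring.
have pz z : z = 0 \/ (K * (Re z ^+ 2 + Im z ^+ 2) < - Re z /\
    Re z ^+ 2 + Im z ^+ 2 <= 1) -> `|p.[z]| <= 1.
  by case=> [->|[? ?]]; [rewrite p0 normr1 | rewrite ltW // pK].
have z1P := mode_eigenvalue K1 L0 mu0 re0 xX gG' yL small1 small2 dE.
have z2P := mode_eigenvalue K1 L0 mu0 re0 xX gG' yL small1 small2 dE'.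
have JE : J ^+ 2 - (d ^+ 2 - D%:C * d) = 0.
  have Jy : J ^+ 2 = - (y ^+ 2)%:C by rewrite /J !expr2; simpc.
  by apply/eqP; rewrite Jy -opprD addrC oppr_eq0 dE.
have quad (z1 := - mu%:C * (x%:C + d)) (z2 := - mu%:C * (x%:C + (D%:C - d)))
    (v := row_mx (a *: u) (b *: u)) :
    v *m Z *m Z = (z1 + z2) *: (v *m Z) - (z1 * z2) *: v.
  rewrite /v !vZ -scaleNr !scale_row_mx add_row_mx /z1 /z2.
  congr row_mx; apply/rowP => j; rewrite !mxE; apply/eqP; rewrite -subr_eq0.
    rewrite (_ : _ - _ = mu%:C ^+ 2 * a * u 0 j * (J ^+ 2 - (d ^+ 2 - D%:C * d))).
      by rewrite JE mulr0.
    by ring.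
  rewrite (_ : _ - _ = mu%:C ^+ 2 * b * u 0 j * (J ^+ 2 - (d ^+ 2 - D%:C * d))).
    by rewrite JE mulr0.
  by ring.
apply: (orbit_bounded_quadratic quad (pz _ z1P) (pz _ z2P)).
case: z1P => /= [z1_eq0 z12|[? ?] _]; last exact: pK.
have muC0 : - mu%:C != 0 by rewrite oppr_eq0 -[0]/(0%:C) (inj_eq (@complexI R)) gt_eqF.
have /(mulfI muC0) xd1 : - mu%:C * (x%:C + d) = - mu%:C * 0 by rewrite mulr0.
have /(mulfI muC0) xd2 : - mu%:C * (x%:C + (D%:C - d)) = - mu%:C * 0.
  by rewrite -z12 mulr0.
have [] : (x + (x + D))%:C = 0%:C.
  rewrite (_ : (x + (x + D))%:C = (x%:C + d) + (x%:C + (D%:C - d))).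
    by rewrite xd1 xd2 addr0.
  by rewrite !rmorphD /=; ring.
have [x0 _] := andP xX.
by move/eqP; rewrite gt_eqF // !ltr_wpDl // mulr_gt0.
Qed.

End Modes.

Theorem theorem5p4 (R : realType) (lm rm lp rp q : nat) (rk : explicit_rk R)
    (hlm : lm = rm.+1 \/ lm = rm.+2) (hlp : lp = rm) (hrp : rp = lm)
    (hq : (1 <= q)%N) (hrk : rk_order_ge rk 1) :
  exists alpha0 beta0 gamma0 : R,
    [/\ 0 < alpha0, 0 < beta0, 0 < gamma0 &
      forall (nu : R) (n : nat) (dt : R),
        let h := n.+1%:R^-1 in
        0 < nu -> 0 < dt ->
        dt < nu * gamma0 ->
        (alpha0 + nu * beta0 / h) * (dt / h) < 1 ->
        stable lm rm lp rp q rk nu n dt].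
Proof.
have [X [G [L [X0 G0 L0 symP]]]] := symbol_bounds R hlm hq.
have [r rE] := rk_polyE rk.
have pE : map_poly (real_complex R) (rk_poly rk) =
    1 + 'X + 'X^2 * map_poly (real_complex R) r.
  by rewrite rE !rmorphD rmorphM rmorph1 /= map_polyX map_polyXn.
have [K K1 KP] := stability_region (map_poly (real_complex R) r).
have K0 : 0 < K by rewrite (lt_le_trans _ K1).
exists (K * (X + 1)), (K * (G + 1)), (2 * K * (L + 1))^-1.
split.
- by rewrite mulr_gt0 // ltr_wpDl.
- by rewrite mulr_gt0 // ltr_wpDl.
- by rewrite invr_gt0 !mulr_gt0 // ltr_wpDl.
move=> nu n dt h nu0 dt0 dt_nu small; rewrite /stable -/h hlp hrp.
have h0 : 0 < h by rewrite invr_gt0 ltr0n.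
set mu := dt / h in small *; set re := nu / h.
have mu0 : 0 < mu by rewrite divr_gt0.
have re0 : 0 < re by rewrite divr_gt0.
have small1 : K * mu * (X + re * G) < 1.
  apply: le_lt_trans small; rewrite [nu * _ / h]mulrAC -/re -subr_ge0.
  rewrite (_ : _ - _ = K * mu * (1 + re)); last by ring.
  by rewrite ltW // mulr_gt0 ?addr_gt0 // (mulr_gt0 K0).
have small2 : 2 * K * mu * L < re.
  move: dt_nu; rewrite ltr_pdivlMr ?mulr_gt0 ?ltr_wpDl //.
  rewrite -(ltr_pM2r (x := h^-1)) ?invr_gt0 //.
  rewrite mulrAC -/mu -/re; apply: lt_trans.
  rewrite -subr_gt0 (_ : _ - _ = 2 * K * mu); last by ring.
  by rewrite (mulr_gt0 _ mu0) // mulr_gt0.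
have [P Pu PS] := shift_mx_diagonalizable R n.
apply: (@power_bounded_complex _ _ _ (block_mx P 0 0 P)).
  rewrite unitmxE (@det_ublock _ n.+1 n.+1). by rewrite unitrM -!unitmxE Pu.
have rows_bounded i a b : orbit_bounded
    (map_mx (real_complex R)
       (horner_mx (mu *: semidisc_mx n lm rm rm lm q re) (rk_poly rk)))
    (row_mx (a *: row i P) (b *: row i P)).
  have [w [w1 Pw]] := PS i.
  have [x [y [g [[F1 F2 xX gG yL] gx]]]] := symP w w1.
  rewrite map_horner_mx pE.
  have p0 : (1 + 'X + 'X^2 * map_poly (real_complex R) r).[0] = 1.
    by rewrite !hornerE expr0n mul0r !addr0.
  exact: (orbit_bounded_mode a b w1 Pw p0 KP K1 L0 mu0 re0 F1 F2 xX gG yL gx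
    small1 small2).
have rowQ (i : 'I_(n.+1 + n.+1)) : exists j a b,
    row i (block_mx P 0 0 P) = row_mx (a *: row j P) (b *: row j P).
  rewrite /block_mx; case: (split_ordP i) => j ->; exists j.
    by exists 1, 0; rewrite rowKu row_row_mx row0 scale1r scale0r.
  by exists 0, 1; rewrite rowKd row_row_mx row0 scale1r scale0r.
by move=> i; have [j [a [b ->]]] := rowQ i; exact: rows_bounded.
Qed.
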